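(* Every modular quantale is stably supported; that is, every modular quantale admits a stable support.
   Context: An involutive quantale is a sup-lattice (complete lattice) $Q$ with an associative multiplication preserving arbitrary joins in each variable and a join-preserving involution $a\mapsto a^*$ with $a^{**}=a$, $(ab)^*=b^*a^*$; it is unital if the multiplication has a unit $e$. A modular quantale is a unital involutive quantale $Q$ satisfying Freyd's modularity axiom: $ab\wedge c\le a(b\wedge a^*c)$ for all $a,b,c\in Q$. A support on a unital involutive quantale $Q$ is a join-preserving map $\varsigma:Q\to Q$ such that $\varsigma(a)\le e$, $\varsigma(a)\le aa^*$ and $a\le\varsigma(a)a$ for all $a\in Q$. It is stable if $\varsigma(ab)=\varsigma(a\varsigma(b))$ for all $a,b\in Q$. A unital involutive quantale is stably supported if it is equipped with a stable support (which is then unique). *)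

(* Defs.v *)
From HB Require Import structures.
From mathcomp Require Import all_boot all_order.
From mathcomp Require Import all_classical.

Set Implicit Arguments.
Unset Strict Implicit.
Unset Printing Implicit Defensive.

Local Open Scope order_scope.
Local Open Scope group_scope.

(* A sup-lattice is a complete lattice.  The binary meet and join are the
   operations of the underlying lattice, hence the greatest lower bound and
   the least upper bound for the order; bottom and top are [sup_of set0]
   and [sup_of setT]. *)
HB.mixin Record isSupLattice (d : Order.disp_t) T of Order.Lattice d T := {
  sup_of : set T -> T;
  sup_ofP : forall A : set T, supremums A (sup_of A)
}.

#[short(type="supLatticeType")]
HB.structure Definition SupLattice (d : Order.disp_t) :=
  { T of Order.Lattice d T & isSupLattice d T }.

(* All joins, including the empty one, are preserved. *)
Definition join_preserving (d d' : Order.disp_t)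
    (T : supLatticeType d) (T' : supLatticeType d') (f : T -> T') : Prop :=
  forall A : set T, f (sup_of A) = sup_of (image A f).

HB.mixin Record isUnitalInvolutiveQuantale (d : Order.disp_t) Q
    of SupLattice d Q & StarMonoid Q := {
  mul_joinl : forall b : Q, join_preserving (fun a : Q => a * b);
  mul_joinr : forall a : Q, join_preserving (fun b : Q => a * b);
  star_join : join_preserving (fun a : Q => a^-1)
}.

(* The product, the unit [1] and the involution are those of a MathComp
   [starMonoidType], whose axioms are those of a monoid together with
   [invgK] and [invgM].  MathComp writes the involution [a^-1]; it is not
   an inverse, and is written [a^*] below. *)
#[short(type="unitalInvolutiveQuantaleType")]
HB.structure Definition UnitalInvolutiveQuantale (d : Order.disp_t) :=
  { Q of SupLattice d Q & StarMonoid Q & isUnitalInvolutiveQuantale d Q }.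

Declare Scope quantale_scope.
Delimit Scope quantale_scope with Qt.
Notation "a ^*" := (a^-1)%g : quantale_scope.
Local Open Scope quantale_scope.

HB.mixin Record isModular (d : Order.disp_t) Q
    of UnitalInvolutiveQuantale d Q := {
  modularity : forall a b c : Q,
    (a * b) `&` c <= a * (b `&` (a^* * c))
}.

#[short(type="modularQuantaleType")]
HB.structure Definition ModularQuantale (d : Order.disp_t) :=
  { Q of UnitalInvolutiveQuantale d Q & isModular d Q }.

Record is_support (d : Order.disp_t) (Q : unitalInvolutiveQuantaleType d)
    (s : Q -> Q) : Prop := IsSupport {
  support_join : join_preserving s;
  support_le_unit : forall a : Q, s a <= 1;
  support_le_mul_star : forall a : Q, s a <= a * a^*;
  le_support_mul : forall a : Q, a <= s a * a
}.

Definition stable (d : Order.disp_t) (Q : unitalInvolutiveQuantaleType d)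
    (s : Q -> Q) : Prop :=
  forall a b : Q, s (a * b) = s (a * s b).

Definition stably_supported (d : Order.disp_t)
    (Q : unitalInvolutiveQuantaleType d) : Prop :=
  exists s : Q -> Q, is_support s /\ stable s.

(* Main.v *)
Require Import Defs.
From HB Require Import structures.
From mathcomp Require Import all_boot all_order.
From mathcomp Require Import all_classical.

(** The stable support is [a |-> 1 /\ a T], where [T] is the top element.  In
    the quantale of binary relations on a set, [a T] relates every point of the
    domain of [a] to everything, so its meet with the identity is the domain of
    [a], as a partial identity.

    Modularity enters through two instances: [a T /\ 1 <= a (T /\ a^* 1)] gives
    [supp a <= a a^*], and the mirror image of modularity applied to
    [1 a /\ a] gives [a <= supp a * a].  Join preservation does not need finite
    meets to distribute over joins.  Modularity also yields the universal
    property [supp_le]: [supp a] lies below any [b <= 1] with [a <= b T].  For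
    [b] the join of the supports of the members of a set, this bounds the
    support of the join.  Stability holds because [b] and [supp b] generate the
    same right ideal, [b T = supp b * T], and [supp (a b)] depends only on
    [a b T]. *)

Set Implicit Arguments.
Unset Strict Implicit.
Unset Printing Implicit Defensive.

Import Order.TTheory.
Local Open Scope classical_set_scope.
Local Open Scope order_scope.
Local Open Scope group_scope.
Local Open Scope quantale_scope.

Section SupLattice.
Variables (d : Order.disp_t) (T : supLatticeType d).
Implicit Types (A : set T) (x y : T).

Lemma le_sup_of A x : A x -> x <= sup_of A.
Proof. by case: (sup_ofP A) => ub _; apply: ub. Qed.

Lemma sup_of_le A y : (forall x, A x -> x <= y) -> sup_of A <= y.
Proof. by case: (sup_ofP A) => _ lub; apply: lub. Qed.

Definition sup_top : T := sup_of setT.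

Lemma le_sup_top x : x <= sup_top.
Proof. exact: le_sup_of. Qed.

Lemma sup_of_pair x y : x <= y -> sup_of [set x; y] = y.
Proof.
move=> le_xy; apply/le_anti/andP; split; last by apply: le_sup_of; right.
by apply: sup_of_le => z [->|->].
Qed.

End SupLattice.

Lemma join_preserving_homo (d d' : Order.disp_t) (T : supLatticeType d)
    (T' : supLatticeType d') (f : T -> T') :
  join_preserving f -> {homo f : x y / x <= y}.
Proof.
move=> fJ x y le_xy; rewrite -(sup_of_pair le_xy) fJ.
by apply: le_sup_of; exists x => //; left.
Qed.

Section InvolutiveQuantale.
Variables (d : Order.disp_t) (Q : unitalInvolutiveQuantaleType d).
Implicit Types a b c : Q.

Lemma le_mul a b a' b' : a <= a' -> b <= b' -> a * b <= a' * b' :> Q.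
Proof.
move=> le_a le_b; apply: (le_trans (join_preserving_homo (mul_joinl b) le_a)).
exact: (join_preserving_homo (mul_joinr a')).
Qed.

Lemma le_star a b : a <= b -> a^* <= b^* :> Q.
Proof. exact: (join_preserving_homo star_join). Qed.

Lemma star_le a b : (a^* <= b) = (a <= b^*).
Proof. by apply/idP/idP => /le_star; rewrite invgK. Qed.

Lemma star_unit : 1^* = 1 :> Q.
Proof. by rewrite -[LHS]mul1g -{1}[1]invgK -invgM mul1g invgK. Qed.

Lemma star_meet a b : (a `&` b)^* = a^* `&` b^* :> Q.
Proof.
apply/le_anti; rewrite lexI !le_star ?leIl ?leIr //=.
by rewrite -[X in X <= _]invgK le_star // lexI !star_le leIl leIr.
Qed.

End InvolutiveQuantale.

Section ModularQuantale.
Variables (d : Order.disp_t) (Q : modularQuantaleType d).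
Implicit Types a b c : Q.
Local Notation T := (sup_top Q).

(** The involution reverses products, so it carries modularity to its mirror
    image. *)
Lemma modularity_right a b c : (a * b) `&` c <= (a `&` (c * b^*)) * b.
Proof.
rewrite -[X in X <= _]invgK star_le star_meet !invgM star_meet invgM.
exact: modularity.
Qed.

Definition supp a : Q := 1 `&` (a * T).

Lemma supp_le_unit a : supp a <= 1.
Proof. exact: leIl. Qed.

Lemma supp_le_mul_star a : supp a <= a * a^*.
Proof.
rewrite /supp meetC (le_trans (modularity _ _ _)) // le_mul //.
by rewrite mulg1 leIr.
Qed.

Lemma le_supp_mul a : a <= supp a * a.
Proof.
(* The mirror modular law for [1 * a /\ a] produces [1 /\ a a^*], which is
   below [supp a] because [a^* <= T]. *)
have := modularity_right 1 a a; rewrite mul1g meetxx => /le_trans; apply.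
by rewrite le_mul // leI2 // le_mul // le_sup_top.
Qed.

(** From [a <= b T], the modular law gives
    [supp a <= b T /\ 1 <= b (T /\ b^* 1) <= b b^*], and [b^* <= 1]. *)
Lemma supp_le a b : b <= 1 -> a <= b * T -> supp a <= b.
Proof.
move=> b1 ab; have aT : a * T <= b * T.
  by rewrite (le_trans (le_mul ab (lexx T))) // -mulgA le_mul // le_sup_top.
rewrite /supp meetC (le_trans (leI2 aT (lexx 1))) //.
rewrite (le_trans (modularity _ _ _)) // -[X in _ <= X]mulg1 le_mul //.
by rewrite mulg1 (le_trans (leIr _ _)) // star_le star_unit.
Qed.

Lemma supp_homo : {homo supp : a b / a <= b}.
Proof. by move=> a b le_ab; rewrite leI2 // le_mul. Qed.

Lemma supp_join : join_preserving supp.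
Proof.
move=> A; apply/le_anti/andP; split; last first.
  by apply: sup_of_le => _ [a Aa <-]; apply/supp_homo/le_sup_of.
apply: supp_le; first by apply: sup_of_le => _ [a _ <-]; exact: supp_le_unit.
apply: sup_of_le => a Aa; apply: (le_trans (le_supp_mul a)).
by rewrite le_mul ?le_sup_top //; apply: le_sup_of; exists a.
Qed.

Lemma supp_mul_top a : supp a * T = a * T.
Proof.
apply/le_anti/andP; split.
  rewrite (le_trans (le_mul (leIr _ _) (lexx T))) // -mulgA.
  by rewrite le_mul // le_sup_top.
rewrite (le_trans (le_mul (le_supp_mul a) (lexx T))) // -mulgA.
by rewrite le_mul // le_sup_top.
Qed.

Lemma supp_stable : stable supp.
Proof. by move=> a b; rewrite {1}/supp -mulgA -supp_mul_top mulgA. Qed.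

Lemma supp_is_support : is_support supp.
Proof.
split.
- exact: supp_join.
- exact: supp_le_unit.
- exact: supp_le_mul_star.
- exact: le_supp_mul.
Qed.

End ModularQuantale.

Theorem theorem2p25 (d : Order.disp_t) (Q : modularQuantaleType d) :
  stably_supported Q.
Proof.
by exists (@supp d Q); split; [exact: supp_is_support | exact: supp_stable].
Qed.
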